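(* Let $X$ be a Baire cosmic vector space, let $Y$ be a Tychonoff space, and let $f:X\to Y$ be a BP-measurable linearly continuous function. Then $f$ is $F_\sigma$-measurable. If, moreover, $Y$ is separable, metrizable, connected and locally path-connected, then $f$ is of the first Baire class.
   Context: All topological vector spaces are over $\mathbb R$ and are assumed to be Hausdorff. A cosmic vector space is a topological vector space which is a continuous image of a separable metrizable space; a Baire cosmic vector space is a cosmic vector space that is a Baire space as a topological space. A function $f:X\to Y$ from a topological vector space $X$ to a topological space $Y$ is linearly continuous if for any $x,v\in X$ the function $\mathbb R\to Y$, $t\mapsto f(x+tv)$, is continuous. A subset $U$ of a topological space $Y$ is functionally open if $U=g^{-1}(V)$ for some continuous $g:Y\to\mathbb R$ and some open $V\subseteq\mathbb R$. A subset $A$ of a topological space $X$ has the Baire property in $X$ if there is an open set $U\subset X$ such that the symmetric difference $U\triangle A$ is meager in $X$. A function $f:X\to Y$ between topological spaces is BP-measurable if for every functionally open $U\subset Y$ the preimage $f^{-1}(U)$ has the Baire property in $X$; it is $F_\sigma$-measurable if for every functionally open $U\subset Y$ the preimage $f^{-1}(U)$ is of type $F_\sigma$ in $X$ (a countable union of closed sets); it is of the first Baire class if it is a pointwise limit of a sequence of continuous functions from $X$ to $Y$. *)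

(* Defs.v *)
From HB Require Import structures.
From mathcomp Require Import all_boot all_order all_algebra.
From mathcomp Require Import all_classical all_reals.
From mathcomp Require Import topology normedtype sequences borel_hierarchy.

Set Implicit Arguments.
Unset Strict Implicit.
Unset Printing Implicit Defensive.

Import Order.TTheory GRing.Theory Num.Theory.
Import numFieldNormedType.Exports.

Local Open Scope classical_set_scope.
Local Open Scope ring_scope.

Definition nowhere_dense (T : topologicalType) (A : set T) : Prop :=
  (closure A)° = set0.

Definition meager (T : topologicalType) (A : set T) : Prop :=
  exists2 F : (set T)^nat,
    (forall n, nowhere_dense (F n)) & A = \bigcup_n F n.

Definition baire_property (T : topologicalType) (A : set T) : Prop :=
  exists2 U : set T, open U & meager (U `+` A).

Definition baire_space (T : topologicalType) : Prop :=
  forall F : (set T)^nat,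
    (forall n, open (F n) /\ dense (F n)) -> dense (\bigcap_n F n).

Definition separable (T : topologicalType) : Prop :=
  exists2 D : set T, countable D & dense D.

Definition metrizable (R : realType) (T : topologicalType) : Prop :=
  exists d : T -> T -> R,
    [/\ forall x y, d x y = 0 <-> x = y,
        forall x y, d x y = d y x,
        forall x y z, d x z <= d x y + d y z &
        forall x, nbhs x =
          filter_from [set e : R | 0 < e] (fun e => [set y | d x y < e])].

Definition cosmic (R : realType) (T : topologicalType) : Prop :=
  exists (Z : topologicalType) (h : Z -> T),
    [/\ separable Z, metrizable R Z, continuous h & range h = [set: T]].

(* [topologicalLmodType] carries no local convexity, unlike [tvsType], but it
   does not include separation either. *)
Definition baire_cosmic_vector_space (R : realType)
    (X : topologicalLmodType R) : Prop :=
  [/\ hausdorff_space X, cosmic R X & baire_space X].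

Definition tychonoff_space (T : topologicalType) : Prop :=
  completely_regular_space T /\ accessible_space T.

Definition path_connected (R : realType) (T : topologicalType)
    (A : set T) : Prop :=
  forall x y, A x -> A y ->
    exists g : R -> T,
      [/\ {within `[0, 1], continuous g}, g 0 = x, g 1 = y &
          g @` `[0, 1] `<=` A].

Definition locally_path_connected (R : realType) (T : topologicalType) : Prop :=
  forall (x : T) (U : set T), nbhs x U ->
    exists V : set T, [/\ open_nbhs x V, V `<=` U & path_connected R V].

Definition functionally_open (R : realType) (T : topologicalType)
    (U : set T) : Prop :=
  exists (g : T -> R) (V : set R), [/\ continuous g, open V & U = g @^-1` V].

Definition linearly_continuous (R : realType) (X : topologicalLmodType R)
    (Y : topologicalType) (f : X -> Y) : Prop :=
  forall x v : X, continuous (fun t : R => f (x + t *: v)).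

Definition BP_measurable (R : realType) (X Y : topologicalType)
    (f : X -> Y) : Prop :=
  forall U : set Y, functionally_open R U -> baire_property (f @^-1` U).

Definition Fsigma_measurable (R : realType) (X Y : topologicalType)
    (f : X -> Y) : Prop :=
  forall U : set Y, functionally_open R U -> Fsigma (f @^-1` U).

Definition first_baire_class (X Y : topologicalType) (f : X -> Y) : Prop :=
  exists2 F : nat -> X -> Y,
    (forall n, continuous (F n)) &
    (forall x, F n x @[n --> \oo] --> f x).

(* Main.v *)
Require Import Defs.
From HB Require Import structures.
From mathcomp Require Import all_boot all_order all_algebra.
From mathcomp Require Import all_classical all_reals.
From mathcomp Require Import topology normedtype sequences borel_hierarchy.
From mathcomp Require Import lra.

Set Implicit Arguments.
Unset Strict Implicit.
Unset Printing Implicit Defensive.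

Import Order.TTheory GRing.Theory Num.Theory.
Import numFieldNormedType.Exports.
Local Open Scope classical_set_scope.
Local Open Scope ring_scope.

(** A functionally open subset of [Y] is the positivity set of a continuous real
    function, so F-sigma measurability concerns sets [0 < h] for a linearly
    continuous real function [h] on [X] whose superlevel sets have the Baire
    property. Up to a meager set, [a < h] is an open set [U]. If [a < h x], then
    along every direction [v] the points [x + v/k] eventually belong to the
    superlevel set; since [X] is Baire and has a countable network, there are
    [n] and a nonmeager network member [N] such that [x + v/k] is in the closure
    of [U] for all [k >= n] and all [v] in [N]. This is a closed condition on [x],
    and by category it implies [a <= h x]. Letting [n] and [N] vary exhibits an
    F-sigma set between [a < h] and [a <= h] ([linearly_continuous_superlevel]);
    the union over [a = 1/m] is [0 < h].

    For the first Baire class, preimages of open sets are F-sigma, and open sets of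
    [X] are F-sigma too because [X], being a topological group with a countable
    network, is completely regular with every closed set a countable intersection
    of zero sets. Hence there are finer and finer levels ([level_sequence]): closed
    covers of [X] whose members are sent by [f] into small path-connected open
    cells of [Y], such that the cells of [x] at successive levels, selected by
    the first index [b_m x] at which [x] enters the cover of level [m], are nested.
    A first index is the eventual value of a sequence of continuous functions
    ([first_index_approx]).

    It remains to turn a sequence of indices into a point of [Y] continuously. As
    the cells of [Y] are merely path-connected, continuous maps into them need not
    extend from closed sets, and all the interpolation is done in the real line:
    for each [n] the cells of the first [n] levels are arranged in a tree with
    digits [0, ..., n], and a single curve visits its leaves in lexicographic order
    without leaving a cell before all its leaves are visited ([tree_curve]).
    Composing the curve with the real-valued base [n+1] expansion whose digits are
    the approximations of [b_0 x, ..., b_(n-1) x] gives a continuous function.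
    Since the digit of each level is exact for all large [n], its value at [x]
    is eventually in each cell of [x], hence converges to [f x]. *)

(** * Countable unions and F-sigma sets *)

Lemma bigcup_unpickle (T : Type) (I : countType) (F : I -> nat -> set T) :
  \bigcup_i \bigcup_k F i k =
  \bigcup_n (if unpickle n is Some (i, k) then F i k else set0).
Proof.
apply/seteqP; split=> x.
  by move=> [i _ [k _ Fx]]; exists (pickle (i, k)); rewrite ?pickleK.
move=> [n _]; case: unpickle => // -[i k] Fx.
by exists i => //; exists k.
Qed.

Section fsigma.
Context {T : topologicalType}.
Implicit Types A B : set T.

Lemma Fsigma_bigcup (I : countType) (A : I -> set T) :
  (forall i, Fsigma (A i)) -> Fsigma (\bigcup_i A i).
Proof.
move=> FA.
have /choice[F HF] : forall i, exists F : nat -> set T,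
    (forall n, closed (F n)) /\ A i = \bigcup_n F n.
  by move=> i; have [F cF AE] := FA i; exists F.
exists (fun n => if unpickle n is Some (i, k) then F i k else set0) => [n|].
  by case: unpickle => [[i k]|]; [exact: (HF i).1|exact: closed0].
by rewrite -bigcup_unpickle; apply: eq_bigcupr => i _; rewrite (HF i).2.
Qed.

Lemma FsigmaI A B : Fsigma A -> Fsigma B -> Fsigma (A `&` B).
Proof.
move=> [F cF ->] [G cG ->].
have -> : (\bigcup_n F n) `&` (\bigcup_n G n) =
    \bigcup_(p : nat * nat) (F p.1 `&` G p.2).
  apply/seteqP; split=> x.
    by move=> [[i _ Fi] [j _ Gj]]; exists (i, j).
  by move=> [[i j] _ [Fi Gj]]; split; [exists i|exists j].
by apply: Fsigma_bigcup => -[i j]; apply: closed_Fsigma; exact: closedI.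
Qed.

End fsigma.

(** * Separable metrizable spaces and their continuous images *)

(** The members of a network are arbitrary sets; this is what lets the notion
    pass to continuous images, which a countable base does not. *)
Definition countable_network (T : topologicalType) (N : nat -> set T) :=
  forall x (U : set T), nbhs x U -> exists i, N i x /\ N i `<=` U.

Section metrizable.
Context {R : realType} {T : topologicalType}.

(** The function is the distance to the complement of [U], written as the
    supremum of the radii at most 1 of balls inside [U], which
    is also meaningful when the complement is empty; it is 1-Lipschitz. *)
Lemma metrizable_open_cozero (U : set T) : metrizable R T -> open U ->
  exists2 g : T -> R, continuous g & U = [set x | 0 < g x].
Proof.
move=> [d [d0 dC dT dn]] oU.
pose S x := [set r : R | 0 <= r <= 1 /\ forall y, d x y < r -> U y].
have dge0 x y : 0 <= d x y.
  have := dT x y x; rewrite (dC y x) (d0 x x).2//; lra.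
have S0 x : S x 0.
  by split; [rewrite lexx ler01|move=> y; rewrite ltNge dge0].
have Sub x : ubound (S x) 1 by move=> r [/andP[_ ->]].
have Ssup x : has_sup (S x) by split; [exists 0; exact: S0|exists 1].
pose g x := sup (S x).
have Sg x r : S x r -> r <= g x by move=> ?; exact: sup_upper_bound.
have lip x y : g x <= g y + d x y.
  apply: ge_sup; first by exists 0.
  move=> r [/andP[r0 r1] rU].
  have [rd|rd] := leP (d x y) r; last first.
    by have := Sg y 0 (S0 y); lra.
  suff /Sg : S y (r - d x y) by lra.
  split; first by have := dge0 x y; lra.
  by move=> z yz; apply: rU; have := dT x y z; lra.
exists g.
  move=> x; apply/cvgrPdist_lt => e e0.
  have : nbhs x [set y | d x y < e] by rewrite dn; exists e.
  apply: filterS => y /= xy.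
  have := lip x y; have := lip y x; rewrite (dC y x) => A B.
  by rewrite ltr_distl; apply/andP; split; lra.
apply/seteqP; split=> x /=.
  move=> Ux; have : nbhs x U by exact: open_nbhs_nbhs.
  rewrite dn => -[e /= e0 eU].
  apply: (@lt_le_trans _ _ (Num.min e 1)); first by rewrite lt_min e0 ltr01.
  apply: Sg; split; first by rewrite ge_min lexx orbT le_min (ltW e0) ler01.
  by move=> y xy; apply: eU; apply: (lt_le_trans xy); rewrite ge_min lexx.
move=> gx; have [r [_ rU] r0] := @sup_adherent _ _ _ gx (Ssup x).
by apply: rU; rewrite (d0 x x).2//; move: r0; rewrite -/(g x); lra.
Qed.

Lemma metrizable_functionally_open (U : set T) : metrizable R T -> open U ->
  functionally_open R U.
Proof.
move=> mT /(metrizable_open_cozero mT)[g cg UE].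
exists g, [set t | 0 < t]; by split => //; exact: open_gt.
Qed.

(** The base consists of the balls of radius [1/(k+1)] around the points of a
    countable dense set, indexed by the code of the centre. *)
Lemma separable_metrizable_base : separable T -> metrizable R T ->
  exists2 B : nat -> set T, (forall i, open (B i)) & countable_network B.
Proof.
move=> [D /countable_injP[q qI] Dd] [d [d0 dC dT dn]].
have ball_open x e : open [set y | d x y < e].
  rewrite openE => y /= xy; rewrite /interior dn.
  exists (e - d x y); first by rewrite /= subr_gt0.
  by move=> z /= yz; have := dT x y z; lra.
pose B (p : nat * nat) :=
  \bigcup_(x in [set x | D x /\ q x = p.1]) [set y | d x y < p.2.+1%:R^-1].
exists (fun n => if unpickle n is Some p then B p else set0).
  move=> n; case: unpickle => [p|]; last exact: open0.
  by apply: bigcup_open => x _; exact: ball_open.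
move=> x U; rewrite dn => -[e /= e0 eU].
have [k ke] : exists k : nat, k.+1%:R^-1 < e / 2.
  have e20 : 0 < e / 2 by lra.
  by have [k] := ltr_add_invr e20; rewrite add0r; exists k.
have k0 : 0 < k.+1%:R^-1 :> R by rewrite invr_gt0.
have [] := Dd [set y | d x y < k.+1%:R^-1].
- by exists x => /=; rewrite (d0 x x).2.
- exact: ball_open.
move=> y [/= xy Dy]; exists (pickle (q y, k)); rewrite pickleK; split.
  by exists y => //=; rewrite dC.
move=> z [y' /= [Dy' qy']].
have -> : y' = y by apply: qI => //; exact: mem_set.
move=> /= yz; apply: eU => /=.
by have := dT x y z; have := lt_trans xy ke; have := lt_trans yz ke; lra.
Qed.

End metrizable.

Lemma cosmic_network (R : realType) (T : topologicalType) : cosmic R T ->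
  exists N : nat -> set T, countable_network N.
Proof.
move=> [Z [h [sZ mZ ch hT]]].
have [B _ BN] := separable_metrizable_base sZ mZ.
exists (fun i => h @` B i) => x U Ux.
have [z _ zx] : range h x by rewrite hT.
rewrite -zx in Ux *.
have [i [Bz BU]] := BN _ _ (ch z _ Ux).
by exists i; split; [exists z|move=> _ [z' /BU + <-]].
Qed.

Lemma real_metrizable (R : realType) : metrizable R R.
Proof.
exists (fun x y => `|x - y|); split=> //.
- by move=> x y; split => [/normr0_eq0/subr0_eq//|->]; rewrite subrr normr0.
- by move=> x y; rewrite distrC.
- by move=> x y z; exact: ler_distD.
Qed.

(** * Baire category *)

Section baire_category.
Context {T : topologicalType}.
Implicit Types A B : set T.

Lemma nowhere_dense_sub A B : A `<=` B -> nowhere_dense B -> nowhere_dense A.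
Proof.
move=> AB B0; apply/seteqP; split=> // x; rewrite -B0.
exact/interiorS/closureS.
Qed.

Lemma meager_sub A B : A `<=` B -> meager B -> meager A.
Proof.
move=> AB [F F0 BE]; exists (fun n => A `&` F n).
  by move=> n; exact: nowhere_dense_sub (F0 n).
by rewrite -setI_bigcupr -BE; apply/esym/setIidPl.
Qed.

Lemma nowhere_dense_meager A : nowhere_dense A -> meager A.
Proof. by move=> A0; exists (fun=> A) => //; rewrite bigcup_const. Qed.

Lemma meager_bigcup (I : countType) (A : I -> set T) :
  (forall i, meager (A i)) -> meager (\bigcup_i A i).
Proof.
move=> mA.
have /choice[F HF] : forall i, exists F : nat -> set T,
    (forall n, nowhere_dense (F n)) /\ A i = \bigcup_n F n.
  by move=> i; have [F cF AE] := mA i; exists F.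
exists (fun n => if unpickle n is Some (i, k) then F i k else set0) => [n|].
  case: unpickle => [[i k]|]; first exact: (HF i).1.
  by rewrite /nowhere_dense closure0 interior0.
by rewrite -bigcup_unpickle; apply: eq_bigcupr => i _; rewrite (HF i).2.
Qed.

Lemma meagerU A B : meager A -> meager B -> meager (A `|` B).
Proof.
move=> mA mB; have := @meager_bigcup bool (fun b => if b then A else B).
have -> : \bigcup_b (if b then A else B) = A `|` B.
  apply/seteqP; split=> x; first by move=> [[] _]; [left|right].
  by move=> [] ?; [exists true|exists false].
by apply; case.
Qed.

Lemma nowhere_dense_boundary A : open A -> nowhere_dense (closure A `\` A).
Proof.
move=> oA; apply/seteqP; split=> // x.
have -> : closure (closure A `\` A) = closure A `\` A.
  apply/esym/closure_id; rewrite setDE; apply: closedI; first exact: closed_closure.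
  exact: open_closedC.
rewrite /interior => xA; have [clAx _] := nbhs_singleton xA.
have [y [Ay [_ nAy]]] := clAx _ xA.
exact: nAy.
Qed.

Lemma open_nonmeager A : baire_space T -> open A -> A !=set0 -> ~ meager A.
Proof.
move=> bT oA A0 [F F0 AE].
have [n|x [Ax xF]] := bT (fun n => ~` closure (F n)) _ A A0 oA.
  split; first exact/closed_openC/closed_closure.
  move=> O [x Ox] oO; apply: contrapT => OF.
  suff : (closure (F n))° x by rewrite F0.
  rewrite /interior; apply: (@filterS _ _ _ O); last exact: open_nbhs_nbhs.
  by move=> y Oy; apply: contrapT => yF; apply: OF; exists y.
move: (Ax); rewrite AE => -[n _ Fx].
by apply: (xF n) => //; exact: subset_closure.
Qed.

(** In a Baire space the nonmeager members of a network do the work of a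
    countable pi-base: [A] is the union of the members inside it, and they cannot
    all be meager. *)
Lemma network_nonmeager N A : baire_space T -> countable_network N ->
  open A -> A !=set0 -> exists i, N i `<=` A /\ ~ meager (N i).
Proof.
move=> bT netN oA A0; apply: contrapT => nN.
apply: (open_nonmeager bT oA A0).
apply: (@meager_sub _ (\bigcup_i (N i `&` [set x | N i `<=` A]))).
  move=> x Ax; have [|i [Nx NA]] := netN x A; first exact: open_nbhs_nbhs.
  by exists i.
apply: meager_bigcup => i; have [NA|NA] := pselect (N i `<=` A).
  apply: (@meager_sub _ (N i)); first by move=> ? [].
  by apply: contrapT => mN; apply: nN; exists i.
apply: nowhere_dense_meager; rewrite (_ : _ `&` _ = set0).
  by rewrite /nowhere_dense closure0 interior0.
by apply/seteqP; split=> // x [].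
Qed.

End baire_category.

Lemma preimage_closure (S T : topologicalType) (g : S -> T) (A : set T) :
  continuous g -> closure (g @^-1` A) `<=` g @^-1` closure A.
Proof.
move=> cg.
have cl : closed (g @^-1` closure A).
  by apply: closed_comp => [x _|]; [exact: cg|exact: closed_closure].
rewrite [X in _ `<=` X](closure_id _).1//.
by apply: closureS => x /= gx; exact: subset_closure.
Qed.

Lemma meager_homeo (S T : topologicalType) (g : S -> T) (g' : T -> S)
    (A : set T) : continuous g -> continuous g' ->
  cancel g g' -> cancel g' g -> meager A -> meager (g @^-1` A).
Proof.
move=> cg cg' gK g'K [F F0 ->]; exists (fun n => g @^-1` F n); last first.
  by rewrite preimage_bigcup.
move=> n; apply/seteqP; split=> // x xF.
suff : (closure (F n))° (g x) by rewrite F0.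
rewrite /interior.
have : nbhs (g' (g x)) (closure (g @^-1` F n)) by rewrite gK.
move=> /(cg' (g x)) nx.
have {}nx : nbhs (g x) (g' @^-1` closure (g @^-1` F n)) := nx.
apply: filterS nx => y /= /(preimage_closure cg) /=.
by rewrite g'K.
Qed.

(** * F-sigma measurability of linearly continuous functions *)

Section linearly_continuous_level.
Context {R : realType} {X : topologicalLmodType R}.

Lemma affine_continuous (x : X) (t : R) : continuous (fun v : X => x + t *: v).
Proof.
move=> v; apply: (@continuous_comp _ _ _ (fun v => (x, t *: v))
  (fun z : X * X => z.1 + z.2)); last exact: add_continuous.
apply: cvg_pair; first exact: cvg_cst.
apply: (@continuous_comp _ _ _ (fun v => (t, v))
  (fun z : R^o * X => z.1 *: z.2)); last exact: scale_continuous.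
by apply: (@cvg_pair _ _ _ _ (nbhs (t : R^o))); [exact: cvg_cst|exact: cvg_id].
Qed.

Lemma translate_continuous (v : X) : continuous (fun x : X => x + v).
Proof.
move=> x; apply: (@continuous_comp _ _ _ (fun x => (x, v))
  (fun z : X * X => z.1 + z.2)); last exact: add_continuous.
by apply: cvg_pair; [exact: cvg_id|exact: cvg_cst].
Qed.

Lemma meager_affine (x : X) (t : R) (A : set X) : t != 0 -> meager A ->
  meager [set v | A (x + t *: v)].
Proof.
move=> t0; apply: (@meager_homeo _ _ (fun v => x + t *: v)
  (fun y => t^-1 *: (y - x))).
- exact: affine_continuous.
- rewrite (_ : (fun _ => _) = (fun y => t^-1 *: -x + t^-1 *: y)).
    exact: affine_continuous.
  by apply/funext => y; rewrite -scalerDr addrC.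
- by move=> v; rewrite addrC addKr scalerA mulVf// scale1r.
- by move=> y; rewrite scalerA divff// scale1r addrC subrK.
Qed.

(** Let [A] be the superlevel set and [U] an open set equal to [A] up to a meager
    set. If [a < h x] then every [v] satisfies [x + v/(k+1)] in [A] for all large
    [k]; by the Baire property of [X] the same holds with the closure of [U]
    instead of [A], uniformly for [k >= n] and [v] in some nonmeager network
    member [N i]. For a given pair [(n, i)] this last condition on [x] is closed.
    Conversely, if it holds, some [v] in [N i] avoids the meager exceptional set,
    so that [a < h (x + v/(k+1))] for [k >= n], and the limit gives [a <= h x]. *)
Lemma linearly_continuous_superlevel (h : X -> R) (a : R) (N : nat -> set X) :
  baire_space X -> countable_network N ->
  (forall x v, continuous (fun t : R => h (x + t *: v))) ->
  baire_property [set x | a < h x] ->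
  exists S : set X, [/\ Fsigma S, [set x | a < h x] `<=` S &
    S `<=` [set x | a <= h x]].
Proof.
move=> bX netN hl [U oU mU].
pose A := [set x | a < h x].
pose s k : R := k.+1%:R^-1.
have s0 k : s k != 0 by rewrite invr_eq0 pnatr_eq0.
have hs x v (V : set R) : nbhs (h x) V ->
    exists n, forall k, (n <= k)%N -> V (h (x + s k *: v)).
  move=> hxV; have := hl x v 0; rewrite /continuous_at scale0r addr0.
  move=> /(_ _ hxV) nV.
  have /(_ _ nV)[n _ nP] := @cvg_harmonic R.
  by exists n.
pose C x n := [set v | forall k, (n <= k)%N -> U (x + s k *: v)].
pose F (p : nat * nat) := [set x | ~ meager (N p.2) /\
  forall k, (p.1 <= k)%N -> forall v, N p.2 v -> closure U (x + s k *: v)].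
exists (\bigcup_p F p); split.
- apply: Fsigma_bigcup => -[n i]; apply: closed_Fsigma.
  have [mN|mN] := pselect (meager (N i)).
    rewrite (_ : F _ = set0); first exact: closed0.
    by apply/seteqP; split=> // x [].
  have -> : F (n, i) = \bigcap_(k in [set k | (n <= k)%N])
      \bigcap_(v in N i) (fun x => x + s k *: v) @^-1` closure U.
    apply/seteqP; split=> x.
      by move=> [_ xU] k nk v Nv; exact: xU.
    by move=> xU; split=> // k nk v Nv; exact: (xU k nk v Nv).
  apply: closed_bigI => k _; apply: closed_bigI => v _.
  apply: closed_comp; last exact: closed_closure.
  by move=> x _; exact: translate_continuous.
- move=> x Ax.
  (* the sets [C x n] exhaust [X] up to a meager set *)
  have [n nC] : exists n, ~ nowhere_dense (C x n).
    apply/existsNP => nC; apply: (@open_nonmeager _ setT bX openT).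
      by exists 0.
    apply: (@meager_sub _ _ (\bigcup_n C x n `|`
        \bigcup_k [set v | (U `+` A) (x + s k *: v)])); last first.
      apply: meagerU; apply: meager_bigcup => k.
        exact/nowhere_dense_meager.
      exact: meager_affine.
    move=> v _.
    have [n nP] := hs x v [set r | a < r] (open_nbhs_nbhs (conj (@open_gt _ a) Ax)).
    have [[k kP]|nk] := pselect (exists k, (U `+` A) (x + s k *: v)).
      by right; exists k.
    left; exists n => // k nk'; apply: contrapT => nU.
    by apply: nk; exists k; right; split=> //; exact: nP.
  have [y yC] : (closure (C x n))° !=set0 by apply/set0P/eqP.
  have [||i [NC mN]] := @network_nonmeager _ N ((closure (C x n))°) bX netN.
  + exact: open_interior.
  + by exists y.
  exists (n, i) => //; split => // k nk v /NC /interior_subset.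
  move=> /(@closureS _ _ ((fun v => x + s k *: v) @^-1` U)) vU.
  apply: (preimage_closure (@affine_continuous x (s k))); apply: vU.
  by move=> w; exact.
- move=> x [[n i] _ [/= mN xU]] /=; rewrite leNgt; apply/negP => hxa.
  apply: mN.
  apply: (@meager_sub _ _ (
      \bigcup_k [set v | (closure U `\` U) (x + s k *: v)] `|`
      \bigcup_k [set v | (U `+` A) (x + s k *: v)])); last first.
    apply: meagerU; apply: meager_bigcup => k; apply: meager_affine => //.
    exact/nowhere_dense_meager/nowhere_dense_boundary.
  move=> v Nv.
  have [m mP] := hs x v [set r | r < a] (open_nbhs_nbhs (conj (@open_lt _ a) hxa)).
  pose k := maxn n m; have := xU k (leq_maxl _ _) v Nv.
  have := mP k (leq_maxr _ _) => /= ha.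
  have [Uk|nUk] := pselect (U (x + s k *: v)) => clU; last by left; exists k.
  right; exists k => //; left; split=> //=.
  by rewrite /A /= => /(lt_trans ha); rewrite ltxx.
Qed.

(** A functionally open set of [Y] is the positivity set of one real function, so
    its preimage is [0 < h] for a linearly continuous real [h]; this is the union
    over [m] of F-sigma sets between [1/(m+1) < h] and [1/(m+1) <= h]. *)
Lemma linearly_continuous_Fsigma (Y : topologicalType) (f : X -> Y) :
  baire_space X -> cosmic R X -> BP_measurable R f -> linearly_continuous f ->
  Fsigma_measurable R f.
Proof.
move=> bX /cosmic_network[N netN] fBP lf U [g [V [cg oV UE]]].
have [p cp VE] := metrizable_open_cozero (real_metrizable R) oV.
pose h x := p (g (f x)).
have cpg : continuous (p \o g).
  by move=> y; apply: continuous_comp; [exact: cg|exact: cp].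
have hl x v : continuous (fun t : R => h (x + t *: v)).
  by move=> t; exact: (continuous_comp (lf x v t) (cpg _)).
have hBP a : baire_property [set x | a < h x].
  apply: (fBP [set y | a < p (g y)]); exists (p \o g), [set r | a < r].
  by split => //; exact: open_gt.
have /choice[S HS] : forall m : nat, exists S : set X,
    [/\ Fsigma S, [set x | m.+1%:R^-1 < h x] `<=` S &
    S `<=` [set x | m.+1%:R^-1 <= h x]].
  by move=> m; exact: linearly_continuous_superlevel bX netN hl (hBP _).
rewrite (_ : f @^-1` U = \bigcup_m S m).
  by apply: Fsigma_bigcup => m; have [] := HS m.
rewrite UE VE; apply/seteqP; split=> x /=.
  move=> hx; have [m] := ltr_add_invr hx; rewrite add0r => mh.
  by exists m => //; have [_ + _] := HS m; exact.
move=> [m _ Sx]; have [_ _ /(_ _ Sx)] := HS m; apply: lt_le_trans.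
by rewrite invr_gt0.
Qed.

End linearly_continuous_level.

(** * Complete regularity of topological groups *)

(** The additive uniformity of a topological abelian group is carried by a
    copy of the group, whose own topology need not come with a uniformity. *)
Definition group_uniformity (X : topologicalZmodType) : Type := X.

Section group_uniformity.
Context {X : topologicalZmodType}.

Definition group_entourage : set_system (X * X) :=
  fun E => exists2 U : set X, nbhs 0 U & [set p | U (p.1 - p.2)] `<=` E.

Lemma group_entourage_filter : Filter group_entourage.
Proof.
split; first by exists setT => //; exact: filterT.
  move=> P Q [U U0 UP] [V V0 VQ]; exists (U `&` V); first exact: filterI.
  by move=> p [/UP Pp /VQ Qp].
by move=> P Q PQ [U U0 UP]; exists U => // p /UP /PQ.
Qed.

Lemma group_entourage_refl (E : set (X * X)) :
  group_entourage E -> diagonal `<=` E.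
Proof.
move=> [U U0 UE] [x y] /= xy; apply: UE => /=.
by rewrite /diagonal /= in xy; rewrite xy subrr; exact: nbhs_singleton.
Qed.

Lemma group_entourage_inv (E : set (X * X)) :
  group_entourage E -> group_entourage (E^-1)%relation.
Proof.
move=> [U U0 UE]; exists (-%R @^-1` U).
  by have := @opp_continuous X 0; rewrite /continuous_at oppr0; exact.
by move=> [x y] /= Uxy; apply: UE => /=; rewrite -opprB.
Qed.

Lemma group_entourage_split (E : set (X * X)) : group_entourage E ->
  exists2 D, group_entourage D & (D \; D)%relation `<=` E.
Proof.
move=> [U U0 UE].
have := @add_continuous X (0, 0); rewrite /continuous_at /= addr0 => /(_ U U0).
move=> [[V W] /= [V0 W0] VW].
exists [set p | (V `&` W) (p.1 - p.2)]; first by exists (V `&` W) => //; exact: filterI.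
move=> [x y] [z [/= xz _] [_ /= zy]]; apply: UE => /=.
by rewrite -(subrK z x) -addrA; exact: (VW (x - z, z - y)).
Qed.

HB.instance Definition _ := Choice.on (group_uniformity X).
HB.instance Definition _ := @isUniform.Build (group_uniformity X)
  group_entourage group_entourage_filter group_entourage_refl
  group_entourage_inv group_entourage_split.

End group_uniformity.

Lemma topological_group_completely_regular (X : topologicalZmodType) :
  completely_regular_space X.
Proof.
move=> a B cB nBa.
have nB : nbhs 0 [set u : X | ~ B (a - u)].
  have : nbhs (a - 0) (~` B).
    by rewrite subr0; apply: open_nbhs_nbhs; split=> //; rewrite openC.
  move=> /(@sub_continuous X (a, 0)) [[V W] /= [Va W0] VW].
  apply: filterS W0 => u Wu; apply: (VW (a, u)); split => //=.
  exact: nbhs_singleton.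
exists (Uniform.class (group_uniformity X)), [set p | ~ B (a - (p.1 - p.2))].
split.
- by exists [set u : X | ~ B (a - u)].
- apply/seteqP; split => // -[x y] [[/= -> By]].
  by rewrite opprB addrC subrK.
- move=> x U; rewrite -[@nbhs _ _]/(@nbhs (group_uniformity X) _).
  rewrite -nbhs_entourageE => -[E [V V0 VE] EU].
  have : nbhs (x - x) V by rewrite subrr.
  move=> /(@sub_continuous X (x, x)) [[P Q] /= [Px Qx] PQ].
  apply: filterS Qx => y Qy; apply: EU; apply/mem_set/VE/(PQ (x, y)).
  by split; [exact: (nbhs_singleton Px)|exact: Qy].
Qed.

(** * Approximating the indicator of an open set *)

Section closed_indicators.
Context {R : realType} {X : topologicalType}.

(** The indicator of the complement of a closed set is an eventually constant
    pointwise limit of continuous functions: choose one bump function for each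
    network member that admits a positive one, and truncate [n] times the sum of
    the first [n] of them. *)
Lemma closed_indicator_approx (N : nat -> set X) (F : set X) :
  @completely_regular_space X -> countable_network N -> closed F ->
  exists psi : nat -> X -> R, [/\ forall n, continuous (psi n),
    forall n x, 0 <= psi n x <= 1, forall n x, F x -> psi n x = 0 &
    forall x, ~ F x -> exists n0, forall n, (n0 <= n)%N -> psi n x = 1].
Proof.
move=> crX netN cF.
pose bump (p : X -> R) :=
  [/\ continuous p, forall x, 0 <= p x & forall x, F x -> p x = 0].
have /choice[p Hp] : forall i, exists p : X -> R, bump p /\
    ((exists q, bump q /\ forall x, N i x -> 0 < q x) ->
      forall x, N i x -> 0 < p x).
  move=> i; have [[q [bq qi]]|nq] :=
      pselect (exists q, bump q /\ forall x, N i x -> 0 < q x).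
    by exists q.
  by exists (fun=> 0); split => //; split => // x; exact: cvg_cst.
have pN x : ~ F x -> exists i, 0 < p i x.
  move=> nFx; have /(uniform_separatorP (R := R))[q [cq q01 q0 q1]] := crX x F cF nFx.
  have qx : q x = 0 by apply: q0; exists x.
  have [|i [Nx Ni]] := netN x [set y | 0 < 1 - q y].
    apply: open_nbhs_nbhs; split; last by rewrite /= qx subr0.
    rewrite (_ : [set _ | _] = q @^-1` [set t | t < 1]).
      by apply: open_comp => [y _|]; [exact: cq|exact: open_lt].
    by apply/seteqP; split=> y /=; rewrite subr_gt0.
  exists i; apply: (Hp i).2 => //; exists (fun y => 1 - q y); split=> //; split.
  - by move=> y; apply: continuousB; [exact: cvg_cst|exact: cq].
  - move=> y; have : `[0, 1]%classic (q y) by apply: q01; exists y.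
    by rewrite /= in_itv/= => /andP[_]; rewrite subr_ge0.
  - by move=> y Fy; rewrite (q1 (q y)) ?subrr//; exists y.
exists (fun n x => Num.min 1 (n%:R * \sum_(i < n) p i x)); split.
- move=> n x; apply: (@continuous_min R X (fun=> 1)); first exact: cvg_cst.
  apply: continuousM; first exact: cvg_cst.
  move: x; apply: continuous_big => [|i _]; first exact: add_continuous.
  by have [[]] := Hp i.
- move=> n x; rewrite le_min ler01 ge_min lexx !andbT/=.
  apply: mulr_ge0 => //; apply: sumr_ge0 => i _.
  by have [[_ + _] _] := Hp i.
- move=> n x Fx; rewrite big1 ?mulr0 ?min_r// => i _.
  by have [[_ _ +] _] := Hp i; exact.
- move=> x /pN[i pi0].
  have [m mP] : exists m : nat, (p i x)^-1 <= m%:R.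
    exists (Num.truncn (p i x)^-1).+1; apply/ltW; exact: truncnS_gt.
  exists (maxn i.+1 m) => n; rewrite geq_max => /andP[ni nm].
  apply/min_idPl.
  have ps : p i x <= \sum_(i < n) p i x.
    rewrite (bigD1 (Ordinal ni))//= lerDl; apply: sumr_ge0 => j _.
    by have [[_ + _] _] := Hp j.
  rewrite -[X in X <= _](@mulVf _ (p i x)) ?gt_eqF//.
  apply: ler_pM => //; [by rewrite invr_ge0 ltW|exact: ltW|].
  by apply: (le_trans mP); rewrite ler_nat.
Qed.

Lemma open_Fsigma (N : nat -> set X) (U : set X) :
  @completely_regular_space X -> countable_network N -> open U -> Fsigma U.
Proof.
move=> crX netN oU.
have [psi [cpsi _ psi0 psi1]] :=
  closed_indicator_approx crX netN (open_closedC oU).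
exists (fun n => psi n @^-1` [set t | 1 <= t]).
  move=> n; apply: closed_comp => [x _|]; [exact: cpsi|exact: closed_ge].
apply/seteqP; split=> x.
  move=> Ux; have [//|n nP] := psi1 x.
  by exists n => //=; rewrite nP.
move=> [n _ /=]; apply: contraPP => nUx.
by rewrite psi0// ler10.
Qed.

End closed_indicators.

(** * First index of membership in a sequence of closed sets *)

Section first_index.
Context {T : Type}.
Implicit Types F : nat -> set T.

Definition first_index F (k : nat) : set T :=
  F k `\` \bigcup_(l in `I_k) F l.

Lemma first_index_inj F k l x :
  first_index F k x -> first_index F l x -> k = l.
Proof.
move=> [Fk nk] [Fl nl]; case: (ltngtP k l) => // kl.
  by exfalso; apply: nl; exists k.
by exfalso; apply: nk; exists l.
Qed.

Lemma first_index_exists F x : (\bigcup_k F k) x -> exists k, first_index F k x.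
Proof.
move=> [n _ Fn].
have Fex : exists n, `[< F n x >] by exists n; exact/asboolP.
exists (ex_minn Fex); case: ex_minnP => k /asboolP Fk kmin; split=> // -[l /= lk].
by move=> /asboolP/kmin; rewrite leqNgt lk.
Qed.

End first_index.

Section first_index_closed.
Context {R : realType} {X : topologicalType}.
Variable N : nat -> set X.
Hypotheses (crX : @completely_regular_space X) (netN : countable_network N).

Lemma first_index_Fsigma (F : nat -> set X) k : (forall l, closed (F l)) ->
  Fsigma (first_index F k).
Proof.
move=> cF; rewrite /first_index setDE; apply: FsigmaI; first exact: closed_Fsigma.
apply: (open_Fsigma (R := R) crX netN); apply: closed_openC.
by apply: closed_bigcup; [exact: finite_II|move=> l _; exact: cF].
Qed.

(** The first index [k] of [x] counts the [j] such that [x] lies in none of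
    [F 0, ..., F j]. Replacing the indicators of the complements by their
    continuous approximations yields continuous functions that are eventually
    equal to [k] at [x]. *)
Lemma first_index_approx (F : nat -> set X) : (forall l, closed (F l)) ->
  exists c : nat -> X -> R, [/\ forall n, continuous (c n),
    forall n x, 0 <= c n x <= n%:R &
    forall k x, first_index F k x ->
      exists n0, forall n, (n0 <= n)%N -> c n x = k%:R].
Proof.
move=> cF.
have /choice[psi Hpsi] := fun l => closed_indicator_approx (R := R) crX netN (cF l).
exists (fun n x => \sum_(j < n) \prod_(l < j.+1) psi l n x); split.
- move=> n; apply: continuous_big => [|j _]; first exact: add_continuous.
  apply: continuous_big => [|l _]; first exact: mul_continuous.
  by have [] := Hpsi l.
- move=> n x; have psi01 l : 0 <= psi l n x <= 1 by have [] := Hpsi l.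
  apply/andP; split.
    apply: sumr_ge0 => j _; apply: prodr_ge0 => l _.
    by have /andP[] := psi01 l.
  have -> : n%:R = \sum_(j < n) 1 :> R by rewrite sumr_const card_ord.
  by apply: ler_sum => j _; apply: Num.Theory.prodr_ile1 => l _.
- move=> k x [Fk nF].
  have /choice[m mP] : forall l, exists m, (l < k)%N ->
      forall n, (m <= n)%N -> psi l n x = 1.
    move=> l; have [lk|kl] := ltnP l k; last by exists 0%N.
    have [_ _ _ /(_ x)[Fl|m mP]] := Hpsi l; last by exists m.
    by apply: nF; exists l.
  exists (maxn k (\max_(l < k) m l)) => n; rewrite geq_max => /andP[kn mn].
  have psi1 l : (l < k)%N -> psi l n x = 1.
    move=> lk; apply: mP => //; apply: leq_trans mn.
    exact: (leq_bigmax (Ordinal lk)).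
  transitivity (\sum_(j < n) ((j < k)%N)%:R : R).
    apply: eq_bigr => j _; have [jk|kj] := ltnP j k.
      by rewrite big1// => l _; apply: psi1; apply: leq_trans jk; rewrite ltnS -ltnS.
    (* the factor of index [k] vanishes *)
    rewrite (bigD1 (Ordinal (kj : (k < j.+1)%N)))//=.
    by have [_ _ -> //] := Hpsi k; rewrite mul0r.
  rewrite -natr_sum; congr (_%:R).
  rewrite -[RHS](card_ord k) -sum1_card -(subnKC kn) big_split_ord/=.
  rewrite [X in (_ + X)%N]big1 => [|i _]; last by rewrite ltnNge leq_addr.
  by rewrite addn0; apply: eq_bigr => i _; rewrite ltn_ord.
Qed.

End first_index_closed.

(** * Refining sequences of closed covers *)

Section levels.
Context {R : realType} {X Y : topologicalType}.
Variables (N : nat -> set X) (B : nat -> set Y) (d : Y -> Y -> R) (f : X -> Y).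
Hypotheses (crX : @completely_regular_space X) (netN : countable_network N).
Hypotheses (oB : forall i, open (B i)) (netB : countable_network B).
Hypotheses (dC : forall x y, d x y = d y x)
  (dT : forall x y z, d x z <= d x y + d y z)
  (dn : forall x e, 0 < e -> nbhs x [set y | d x y < e]).
Hypothesis pcY : path_connected R [set: Y].
Hypothesis lpcY : locally_path_connected R Y.
Hypothesis fS : forall U, open U -> Fsigma (f @^-1` U).

(** A level is a sequence of closed sets of [X], each paired with a cell of [Y]
    that contains its image. *)
Definition level : Type := (nat -> set X) * (nat -> set Y).

Definition good_cell (A : set X) (U : set Y) :=
  [/\ closed A, open U, path_connected R U, U !=set0 & forall x, A x -> U (f x)].

Definition good_level (L : level) :=
  (forall k, good_cell (L.1 k) (L.2 k)) /\ \bigcup_k L.1 k = setT.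

Definition fine_level (e : R) (L : level) :=
  forall k x, L.1 k x -> forall y, L.2 k y -> d (f x) y < e.

(** Refinement is relative to the first index in [L], not to an arbitrary one:
    the cells met by a point at successive levels, chosen by first index, are then
    nested. *)
Definition refines (L L' : level) :=
  forall k' x, L'.1 k' x -> exists k, first_index L.1 k x /\ L'.2 k' `<=` L.2 k.

(** The set of points of first index [k] whose image lies in the base set [B i] is
    F-sigma; its closed pieces form the new level, whenever [B i] is contained in
    some small path-connected open subset of the cell [k], which becomes the new
    cell. The remaining codes carry the empty set and the whole of [Y]. *)
Lemma level_refinement e L : 0 < e -> good_level L ->
  exists L', [/\ good_level L', fine_level e L' & refines L L'].
Proof.
move=> e0 [gL cL].
have /choice[C HC] : forall p : nat * nat, exists C : nat -> set X,
    (forall j, closed (C j)) /\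
    first_index L.1 p.1 `&` f @^-1` (B p.2) = \bigcup_j C j.
  move=> [k i]; have [C cC CE] : Fsigma (first_index L.1 k `&` f @^-1` (B i)).
    apply: FsigmaI; last exact: fS.
    by apply: (first_index_Fsigma (R := R) crX netN) => l; have [] := gL l.
  by exists C.
pose small k i (V : set Y) := [/\ [/\ open V, path_connected R V & V !=set0],
  B i `<=` V, V `<=` L.2 k & forall y z, V y -> V z -> d y z < e].
pose cell n (c : set X * set Y) := [/\ good_cell c.1 c.2,
  forall x, c.1 x -> forall y, c.2 y -> d (f x) y < e,
  forall x, c.1 x -> exists k, first_index L.1 k x /\ c.2 `<=` L.2 k &
  forall k i j : nat, n = pickle (k, i, j) -> (exists V, small k i V) ->
    c.1 = C (k, i) j].
have [y0 _] : exists y0 : Y, True by have [_ _ _ [y _] _] := gL 0%N; exists y.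
have cell0 n : (forall k i j : nat, n = pickle (k, i, j) -> ~ exists V, small k i V) ->
    cell n (set0, setT).
  move=> nk; split=> //=; last by move=> k i j nE eV; case: (nk _ _ _ nE eV).
  split => //=; [exact: closed0|exact: openT|by exists y0].
have /choice[c Hc] : forall n, exists c, cell n c.
  move=> n; have [[[[k i] j] [nE [V sV]]]|nk] := pselect (exists p : nat * nat * nat,
      n = pickle p /\ exists V, small p.1.1 p.1.2 V); last first.
    exists (set0, setT); apply: cell0 => k i j nE eV; apply: nk.
    by exists (k, i, j).
  have [cC CE] := HC (k, i); have [[oV pV V0] BV VL sm] := sV.
  have CV x : C (k, i) j x -> first_index L.1 k x /\ V (f x).
    move=> Cx; have : (first_index L.1 k `&` f @^-1` B i) x by rewrite CE; exists j.
    by move=> [? /BV].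
  exists (C (k, i) j, V); split=> /=.
  - by split => // x /CV[].
  - by move=> x /CV[_ Vx] y; exact: sm.
  - by move=> x /CV[kx _]; exists k.
  - move=> k' i' j'; rewrite nE => /(pcan_inj pickleK)[<- <- <-] _.
    by [].
exists (fun n => (c n).1, fun n => (c n).2); split.
- split; first by move=> n; have [] := Hc n.
  apply/seteqP; split=> // x _.
  have [|k kx] := @first_index_exists _ L.1 x; first by rewrite cL.
  have [_ oU _ _ Ux] := gL k.
  have e20 : 0 < e / 2 by lra.
  have [V [[oV Vx] VU pV]] := lpcY (filterI (open_nbhs_nbhs (conj oU (Ux _ kx.1)))
    (dn (f x) e20)).
  have [i [Bi BV]] := netB (open_nbhs_nbhs (conj oV Vx)).
  have [j _ Cj] : (\bigcup_j C (k, i) j) x by rewrite -(HC (k, i)).2.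
  exists (pickle (k, i, j)) => //=.
  have [_ _ _ /(_ _ _ _ erefl) ->//] := Hc (pickle (k, i, j)).
  exists V; split => //; [by split=> //; exists (f x)|by move=> y /VU[]|].
  move=> y z /VU[_ /= dy] /VU[_ /= dz]; have := dT y (f x) z; rewrite (dC y (f x)).
  by lra.
- by move=> n x; have [_ + _ _] := Hc n; exact.
- by move=> n x; have [_ _ + _] := Hc n; exact.
Qed.

Lemma level_sequence (y0 : Y) : exists L : nat -> level,
  [/\ forall m, good_level (L m), forall m, fine_level m.+1%:R^-1 (L m.+1) &
    forall m, refines (L m) (L m.+1)].
Proof.
pose GL := {L : level | good_level L}.
have /choice[next Hnext] : forall p : nat * GL, exists L' : GL,
    fine_level p.1.+1%:R^-1 (sval L') /\ refines (sval p.2) (sval L').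
  move=> [m [L gL]]; have [||L' [gL' fL' rL']] := @level_refinement m.+1%:R^-1 L.
  - by rewrite invr_gt0.
  - by [].
  by exists (exist _ L' gL').
have gL0 : good_level (fun=> setT, fun=> setT).
  split; last by rewrite bigcup_const.
  by move=> k; split => //=; by [exact: closedT|exact: openT|exists y0].
pose L := fix L m : GL := if m is m'.+1 then next (m', L m') else exist _ _ gL0.
exists (fun m => sval (L m)); split => m /=.
- exact: (proj2_sig (L m)).
- by have [] := Hnext (m, L m).
- by have [] := Hnext (m, L m).
Qed.

End levels.

(** * Joining points by curves *)

Section paths.
Context {R : realType} {Y : topologicalType}.
Implicit Types (S : set Y) (x y : Y).

(** Paths are prolonged to the whole line by constants, so that continuity is
    that of functions defined everywhere and concatenation is a single pasting. *)
Definition joined S x y := exists g : R -> Y,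
  [/\ continuous g, forall t, t <= 0 -> g t = x, forall t, 1 <= t -> g t = y &
    forall t, S (g t)].

Lemma continuous_paste (c : R) (g h : R -> Y) :
  continuous g -> continuous h -> g c = h c ->
  continuous (fun t => if t <= c then g t else h t).
Proof.
move=> cg ch gh t; rewrite /continuous_at.
have [tc|ct|tc] := ltgtP t c.
- apply: cvg_trans (cg t); apply: near_eq_cvg.
  have : \forall s \near t, s < c by exact: lt_nbhsl.
  by apply: filterS => s /ltW ->.
- apply: cvg_trans (ch t); apply: near_eq_cvg.
  have : \forall s \near t, c < s by exact: lt_nbhsr.
  by apply: filterS => s cs; rewrite leNgt cs.
- move=> U gU; have hU : nbhs (h t) U by rewrite tc -gh -tc.
  have {}gU : nbhs t (g @^-1` U) := cg t _ gU.
  have {}hU : nbhs t (h @^-1` U) := ch t _ hU.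
  change (nbhs t [set s | U (if s <= c then g s else h s)]).
  by apply: filterS (filterI gU hU) => s /= [gs hs]; case: ifP.
Qed.

Lemma joined_mem S x y : joined S x y -> S x /\ S y.
Proof.
by move=> [g [_ g0 g1 gS]]; split; [rewrite -(g0 0)|rewrite -(g1 1)].
Qed.

Lemma path_connected_joined S x y : path_connected R S -> S x -> S y ->
  joined S x y.
Proof.
move=> pS Sx Sy; have [g [cg g0 g1 gS]] := pS x y Sx Sy.
have cl01 (t : R) : `[0, 1]%classic (Num.max 0 (Num.min 1 t)).
  by rewrite /= in_itv/= le_max lexx/= ge_max ler01 ge_min lexx.
exists (fun t => g (Num.max 0 (Num.min 1 t))); split.
- move=> t U gU.
  have /subspace_continuousP/(_ _ (cl01 t) U gU) := cg.
  rewrite nbhs_simpl /within /= => nU.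
  change (nbhs t [set s | U (g (Num.max 0 (Num.min 1 s)))]).
  suff : nbhs t [set s | `[0, 1]%classic (Num.max 0 (Num.min 1 s)) ->
      U (g (Num.max 0 (Num.min 1 s)))].
    by apply: filterS => s; apply; exact: cl01.
  have clc : {for t, continuous (fun s : R => Num.max 0 (Num.min 1 s))}; last first.
    exact: clc nU.
  apply: (@continuous_max R R (fun=> 0)); first exact: cvg_cst.
  by apply: (@continuous_min R R (fun=> 1)); [exact: cvg_cst|exact: cvg_id].
- by move=> t t0; rewrite min_r ?max_l// (le_trans t0)// ler01.
- by move=> t t1; rewrite min_l// max_r// ler01.
- by move=> t; apply: gS; exists (Num.max 0 (Num.min 1 t)).
Qed.

Lemma joined_trans S x y z : joined S x y -> joined S y z -> joined S x z.
Proof.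
move=> [g [cg g0 g1 gS]] [h [ch h0 h1 hS]].
exists (fun t => if t <= 2^-1 then g (2 * t) else h (2 * t - 1)); split.
- apply: (@continuous_paste _ (g \o (fun t => 2 * t)) (h \o (fun t => 2 * t - 1))).
  + move=> t; apply: continuous_comp; last exact: cg.
    by apply: mulrl_continuous.
  + move=> t; apply: continuous_comp; last exact: ch.
    apply: (@cvgB _ R^o); last exact: cvg_cst.
    by apply: mulrl_continuous.
  + by rewrite /= g1 ?h0//; lra.
- by move=> t t0; rewrite ifT ?g0//; lra.
- by move=> t t1; rewrite ifF ?h1//; [lra|apply/negbTE; rewrite -ltNge; lra].
- by move=> t; case: ifP.
Qed.

(** The points joined to [x] form a set that is open and closed. *)
Lemma connected_locally_path_connected :
  connected [set: Y] -> locally_path_connected R Y ->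
  forall x y, joined setT x y.
Proof.
move=> cY lpY x.
have nbhs_joined z : nbhs z [set w | joined setT z w /\ joined setT w z].
  have [V [[oV Vz] _ pV]] := lpY z setT filterT.
  apply: (@filterS _ _ _ V); last exact: open_nbhs_nbhs.
  have sT u v : V u -> V v -> joined setT u v.
    move=> Vu Vv; have [g [cg g0 g1 _]] := path_connected_joined pV Vu Vv.
    by exists g.
  by move=> w Vw; split; exact: sT.
have oP : open [set y | joined setT x y].
  rewrite openE => y xy; rewrite /interior.
  apply: filterS (nbhs_joined y) => z [yz _]; exact: joined_trans yz.
have cP : closed [set y | joined setT x y].
  move=> y /(_ _ (nbhs_joined y))[z [/= xz [_ zy]]]; exact: joined_trans zy.
suff PT : [set y | joined setT x y] = setT.
  by move=> y; change ([set y | joined setT x y] y); rewrite PT.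
apply: cY.
- by exists x => /=; have [] := nbhs_singleton (nbhs_joined x).
- by exists [set y | joined setT x y]; rewrite ?setTI.
- by exists [set y | joined setT x y]; rewrite ?setTI.
Qed.

Lemma joined_path_connected S :
  (forall x y, S x -> S y -> joined S x y) -> path_connected R S.
Proof.
move=> jS x y Sx Sy; have [g [cg g0 g1 gS]] := jS x y Sx Sy.
exists g; split; [exact: continuous_subspaceT|exact: g0|exact: g1|].
by move=> _ [t _ <-].
Qed.

Lemma joined_chain (S : nat -> set Y) (y : nat -> Y) :
  (forall k, joined (S k) (y k) (y k.+1)) ->
  forall K, exists g : R -> Y, [/\ continuous g,
    forall t, K%:R <= t -> g t = y K,
    forall k, (k <= K)%N -> g k%:R = y k &
    forall k t, (k < K)%N -> k%:R <= t <= k.+1%:R -> S k (g t)].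
Proof.
move=> jS; elim=> [|K [g [cg gK gk gS]]].
  exists (fun=> y 0%N); split=> //; first by move=> t; exact: cvg_cst.
  by move=> k; rewrite leqn0 => /eqP ->.
have [h [ch h0 h1 hS]] := jS K.
have KK1 : K%:R < K.+1%:R :> R by rewrite ltr_nat.
exists (fun t => if t <= K%:R then g t else h (t - K%:R)); split.
- apply: (@continuous_paste _ g (h \o (fun t => t - K%:R))) => //.
    move=> t; apply: continuous_comp; last exact: ch.
    by apply: (@cvgB _ R^o); [exact: cvg_id|exact: cvg_cst].
  by rewrite /= subrr h0// gk.
- move=> t Kt; rewrite ifF; last by apply/negbTE; rewrite -ltNge; lra.
  by apply: h1; rewrite -natr1 in Kt; lra.
- move=> k; rewrite leq_eqVlt => /predU1P[->|kK].
    rewrite ifF; last by apply/negbTE; rewrite -ltNge.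
    by apply: h1; rewrite -natr1; lra.
  by rewrite ifT ?gk// ler_nat.
- move=> k t; rewrite ltnS leq_eqVlt => /predU1P[->|kK] /andP[kt tk].
    case: ifP => // tK; have -> : t = K%:R by apply/eqP; rewrite eq_le tK kt.
    by rewrite gk//; have [] := joined_mem (jS K).
  rewrite ifT; first by apply: gS => //; rewrite kt tk.
  by apply: (le_trans tk); rewrite ler_nat.
Qed.

End paths.

(** * A curve through a tree of path-connected cells *)

Section digit_tree.
Context {R : realType} {Y : topologicalType}.
Variables (N : nat) (U : nat -> nat -> set Y).
Hypotheses (N0 : (0 < N)%N) (pcY : path_connected R [set: Y]) (y0 : Y).
Hypotheses (pcU : forall m k, path_connected R (U m k))
  (U0 : forall m k, U m k !=set0).

(** Node [j] of depth [m] is addressed by the [m] base-[N] digits of [j]. Its cell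
    is the one named by the last digit, provided that it lies in the cell of the
    parent [j %/ N]; otherwise it repeats the cell of the parent, which makes
    nesting unconditional. *)
Fixpoint tree_cell (m j : nat) : set Y :=
  if m is m'.+1 then
    if `[< U m' (j %% N)%N `<=` tree_cell m' (j %/ N)%N >] then U m' (j %% N)%N
    else tree_cell m' (j %/ N)%N
  else setT.

(** A set in which the leaves [k] and [k.+1] of depth [n] can be joined: the cell
    of their deepest common ancestor, or all of [Y] if there is none. *)
Fixpoint tree_link (n k : nat) : set Y :=
  if n is n'.+1 then
    if (k %/ N == k.+1 %/ N)%N then tree_cell n' (k %/ N)%N else tree_link n' (k %/ N)%N
  else setT.

Lemma tree_cell_child m j : tree_cell m.+1 j `<=` tree_cell m (j %/ N)%N.
Proof. by move=> y /=; case: asboolP => // UW /UW. Qed.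

Lemma tree_cell_inhabits m j : U m (j %% N)%N `<=` tree_cell m (j %/ N)%N ->
  tree_cell m.+1 j = U m (j %% N)%N.
Proof. by move=> UW /=; case: asboolP. Qed.

Lemma tree_cell_nested m p k : tree_cell (m + p) k `<=` tree_cell m (k %/ N ^ p)%N.
Proof.
elim: p k => [|p IH] k; first by rewrite addn0 expn0 divn1.
rewrite addnS expnS divnMA.
by move=> y /tree_cell_child; exact: IH.
Qed.

Lemma tree_cell_good m j : path_connected R (tree_cell m j) /\ tree_cell m j !=set0.
Proof.
elim: m j => [|m IH] j /=; first by split=> //; exists y0.
by case: asboolP.
Qed.

Lemma succ_divn k : (k.+1 %/ N = k %/ N \/ k.+1 %/ N = (k %/ N).+1)%N.
Proof. by rewrite divnS//; case: (_ %| _)%N; [right|left]. Qed.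

Lemma tree_link_good n k : [/\ path_connected R (tree_link n k),
  tree_cell n k `<=` tree_link n k & tree_cell n k.+1 `<=` tree_link n k].
Proof.
elim: n k => [|n IH] k; first by [].
rewrite [tree_link _ _]/=; case: eqP => kN.
  split; [exact: (tree_cell_good _ _).1|exact: tree_cell_child|].
  by rewrite kN; exact: tree_cell_child.
have [pl lk lk1] := IH (k %/ N)%N; split => //.
  by move=> y /tree_cell_child /lk.
move=> y /tree_cell_child; case: (succ_divn k) => [/esym//|->]; exact: lk1.
Qed.

Lemma tree_link_sub m p j k : (k %/ N ^ p)%N = j -> (k.+1 %/ N ^ p)%N = j ->
  tree_link (m + p) k `<=` tree_cell m j.
Proof.
elim: p k => [|p IH] k.
  by rewrite expn0 !divn1 => -> /eqP; rewrite eqn_leq ltnn.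
rewrite expnS !divnMA addnS /= => kj k1j; case: eqP => [_|kN].
  by rewrite -kj; exact: tree_cell_nested.
by apply: IH => //; case: (succ_divn k) => [/esym//|<-].
Qed.

(** The curve visits one point in each leaf of depth [n], in increasing order, and
    travels between consecutive leaves inside their link. The leaves below the
    node [j] of depth [m] are consecutive, from [j * N ^ p] to
    [j.+1 * N ^ p - 1], so the curve stays in the cell of [j] between those
    times. *)
Lemma tree_curve (n : nat) : exists g : R -> Y, continuous g /\
  forall m p j (t : R), (m + p)%N = n ->
    (j * N ^ p)%:R <= t <= (j.+1 * N ^ p)%:R - 1 -> t <= (N ^ n)%:R ->
    tree_cell m j (g t).
Proof.
have /choice[y yP] : forall k, exists y, tree_cell n k y.
  by move=> k; have [_ [z zk]] := tree_cell_good n k; exists z.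
have jS k : joined (R := R) (tree_link n k) (y k) (y k.+1).
  have [pl lk lk1] := tree_link_good n k.
  by apply: path_connected_joined => //; [exact: lk|exact: lk1].
have [g [cg _ gk gS]] := joined_chain jS (N ^ n).+1.
exists g; split=> // m p j t mpn /andP[jt tj] tn.
have t0 : 0 <= t by apply: le_trans jt.
have [kt tk] : (Num.truncn t)%:R <= t /\ t < (Num.truncn t).+1%:R.
  by split; [rewrite truncn_le|exact: truncnS_gt].
set k := Num.truncn t in kt tk.
have Np : (0 < N ^ p)%N by rewrite expn_gt0 N0.
have jk : (j * N ^ p <= k)%N.
  by rewrite -ltnS -(ltr_nat R); exact: le_lt_trans tk.
have kn : (k < (N ^ n).+1)%N by rewrite -(ltr_nat R) -natr1; lra.
have kj : (k.+1 <= j.+1 * N ^ p)%N.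
  by rewrite -(ler_nat R) -natr1; lra.
have divk l : (j * N ^ p <= l < j.+1 * N ^ p)%N -> (l %/ N ^ p)%N = j.
  move=> /andP[jl lj]; apply/eqP; rewrite eqn_leq leq_divRL// jl andbT.
  by rewrite -ltnS ltn_divLR.
have [k1j|k1j] := ltnP k.+1 (j.+1 * N ^ p).
  have : tree_link n k (g t) by apply: gS => //; rewrite kt ltW.
  rewrite -mpn; apply: tree_link_sub; apply: divk; last by rewrite k1j ltnW.
  by rewrite jk.
(* [t] lies on the last leaf below the node [j] *)
have {kj k1j} kE : k.+1 = (j.+1 * N ^ p)%N by apply/eqP; rewrite eqn_leq kj.
have -> : t = k%:R.
  by apply/eqP; rewrite eq_le kt andbT; move: tj; rewrite -kE -natr1; lra.
rewrite gk; last exact: ltnW.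
have <- : (k %/ N ^ p)%N = j by apply: divk; rewrite jk -kE ltnSn.
by apply: tree_cell_nested; rewrite mpn.
Qed.

End digit_tree.

(** * Base expansions with real digits *)

Section expansion.
Context {R : realType} {X : topologicalType}.

Fixpoint expansion (N : nat) (c : nat -> X -> R) (m : nat) (x : X) : R :=
  if m is m'.+1 then N%:R * expansion N c m' x + c m' x else 0.

Lemma expansion_continuous N c m : (forall i, continuous (c i)) ->
  continuous (expansion N c m).
Proof.
move=> cc; elim: m => [|m IH] x /=; first exact: cvg_cst.
by apply: cvgD; [apply: cvgM; [exact: cvg_cst|exact: IH]|exact: cc].
Qed.

(** Whatever the later digits are, the value stays in the range of the leaves
    below the node reached by the first [m] digits. *)
Lemma expansion_range n c m p (j : nat) x :
  (forall i, 0 <= c i x <= n%:R) -> expansion n.+1 c m x = j%:R ->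
  (j * n.+1 ^ p)%:R <= expansion n.+1 c (m + p) x <= (j.+1 * n.+1 ^ p)%:R - 1.
Proof.
move=> c01 cj; elim: p => [|p /andP[IH1 IH2]].
  by rewrite addn0 expn0 !muln1 cj lexx -natr1 addrK lexx.
have /andP[c0 c1] := c01 (m + p)%N.
rewrite addnS /= expnS (mulnCA j) (mulnCA j.+1) !(natrM _ n.+1).
move: IH1 IH2; set A := (j * _)%:R; set B := (_ * _)%:R; set e := expansion _ _ _ _.
move=> Ae eB.
have N0 : 0 <= n.+1%:R :> R by [].
have := ler_wpM2l N0 Ae; have := ler_wpM2l N0 eB.
have nE : n.+1%:R = n%:R + 1 :> R by rewrite natr1.
by rewrite mulrBr mulr1 => H1 H2; apply/andP; split; lra.
Qed.

End expansion.

(** * Functions of the first Baire class *)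

(** The approximation of index [n] follows the curve through the tree of depth
    [n] with [n.+1] digits, at the time whose digits are the continuous
    approximations of the first indices of [x]. Once the first [m] of these digits
    have become exact, it stays in the cell of [f x] of level [m], which is small. *)
Lemma Fsigma_first_baire_class (R : realType) (X Y : topologicalType)
    (N : nat -> set X) (f : X -> Y) :
  @completely_regular_space X -> countable_network N ->
  separable Y -> metrizable R Y -> connected [set: Y] ->
  locally_path_connected R Y ->
  (forall U, open U -> Fsigma (f @^-1` U)) -> first_baire_class f.
Proof.
move=> crX netN sY mY cY lpcY fS.
have [[x0 _]|X0] := pselect (exists x0 : X, True); last first.
  by exists (fun=> f) => [_ x|x]; case: X0; exists x.
have [B oB netB] := separable_metrizable_base sY mY.
have [d [d0 dC dT dn]] := mY.
have dball x e : 0 < e -> nbhs x [set y | d x y < e] by rewrite dn; exists e.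
have pcY : path_connected R [set: Y].
  apply: joined_path_connected => x y _ _.
  exact: connected_locally_path_connected.
have [L [gL fL rL]] :=
  level_sequence crX netN oB netB dC dT dball pcY lpcY fS (f x0).
have /choice[b bP] : forall m, exists b : X -> nat,
    forall x, first_index (L m).1 (b x) x.
  move=> m; suff /choice[b bP] : forall x, exists k, first_index (L m).1 k x.
    by exists b.
  by move=> x; apply: first_index_exists; rewrite (gL m).2.
have bnest m x : (L m.+1).2 (b m.+1 x) `<=` (L m).2 (b m x).
  have [k [kx kU]] := rL m _ _ (bP m.+1 x).1.
  by rewrite (first_index_inj (bP m x) kx).
have /choice[c cP] m := first_index_approx (R := R) crX netN
  (fun k => let: And5 cF _ _ _ _ := (gL m).1 k in cF).
have pcU m k : path_connected R ((L m).2 k) by have [] := (gL m).1 k.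
have U0 m k : (L m).2 k !=set0 by have [] := (gL m).1 k.
have /choice[g gP] : forall n, exists g : R -> Y, continuous g /\
  forall m p j (t : R), (m + p)%N = n ->
    (j * n.+1 ^ p)%:R <= t <= (j.+1 * n.+1 ^ p)%:R - 1 -> t <= (n.+1 ^ n)%:R ->
    tree_cell n.+1 (fun m => (L m).2) m j (g t).
  by move=> n; exact: (tree_curve (ltn0Sn n) pcY (f x0) pcU U0).
pose u n := expansion n.+1 (fun i => c i n) n.
have c01 n i x : 0 <= c i n x <= n%:R by have [_ + _] := cP i; exact.
exists (fun n => g n \o u n).
  move=> n x; apply: continuous_comp; last exact: (gP n).1.
  by apply: expansion_continuous => i; have [+ _ _] := cP i; exact.
move=> x V; rewrite [nbhs _]dn => -[e /= e0 eV].
have [M] := ltr_add_invr e0; rewrite add0r => Me.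
have /choice[K HK] : forall i, exists n0, forall n, (n0 <= n)%N ->
    c i n x = (b i x)%:R.
  by move=> i; have [_ _ /(_ _ _ (bP i x))] := cP i.
exists (maxn M.+2 (\max_(i < M.+2) K i)) => // n /=.
rewrite geq_max => /andP[Mn Kn]; apply: eV => /=.
have cb i : (i < M.+2)%N -> c i n x = (b i x)%:R.
  move=> iM; apply: HK; apply: leq_trans Kn.
  exact: (leq_bigmax (Ordinal iM)).
have bn i : (i < M.+2)%N -> (b i x <= n)%N.
  by move=> iM; have := c01 n i x; rewrite cb// ler_nat => /andP[].
(* the node reached by the exact digits of [x] *)
pose J := fix J i := if i is i'.+1 then (n.+1 * J i' + b i' x)%N else 0%N.
have uJ i : (i <= M.+2)%N -> expansion n.+1 (fun i => c i n) i x = (J i)%:R.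
  elim: i => [//|i IH] iM /=; rewrite IH ?cb//; last exact: ltnW.
  by rewrite natrD natrM.
have cellJ i : (i < M.+2)%N ->
    tree_cell n.+1 (fun m => (L m).2) i.+1 (J i.+1) = (L i).2 (b i x).
  have Jdiv k : (k < M.+2)%N -> (J k.+1 %% n.+1 = b k x)%N /\ (J k.+1 %/ n.+1 = J k)%N.
    move=> kM /=; rewrite mulnC modnMDl modn_small ?ltnS ?bn//.
    by rewrite divnMDl// divn_small ?ltnS ?bn// addn0.
  elim: i => [|i IH] iM; have [Jm Jd] := Jdiv _ iM.
    by rewrite tree_cell_inhabits ?Jm.
  rewrite tree_cell_inhabits Jm// Jd IH; last exact: ltnW.
  exact: bnest.
apply: (lt_trans _ Me).
apply: (fL M _ _ (bP M.+1 x).1).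
rewrite -(cellJ M.+1)//; apply: (gP n).2 (n - M.+2)%N _ _ _ _ _.
- by rewrite subnKC.
- have := expansion_range (n - M.+2) (c01 n ^~ x) (uJ _ (leqnn _)).
  by rewrite subnKC.
- have := @expansion_range R X n (fun i => c i n) 0%N n 0%N x (c01 n ^~ x) erefl.
  by rewrite mul1n add0n => /andP[_]; rewrite /u => /le_trans; apply; rewrite gerBl.
Qed.

Theorem theorem1p2 (R : realType) (X : topologicalLmodType R)
    (Y : topologicalType) (f : X -> Y)
    (hX : baire_cosmic_vector_space X) (hY : tychonoff_space Y)
    (hBP : BP_measurable R f) (hf : linearly_continuous f) :
  Fsigma_measurable R f /\
  (separable Y -> metrizable R Y -> connected [set: Y] ->
   locally_path_connected R Y -> first_baire_class f).
Proof.
have [_ coX bX] := hX.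
have fS : Fsigma_measurable R f by exact: linearly_continuous_Fsigma.
split=> // sY mY cY lpcY; have [N netN] := cosmic_network coX.
apply: (Fsigma_first_baire_class _ netN sY mY cY lpcY).
  exact: topological_group_completely_regular.
by move=> U oU; apply: fS; exact: metrizable_functionally_open.
Qed.
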